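(* Let $\Omega\subset\mathbb R^2$ be a domain. For every Beltrami--Vekua datum $D=(\mu,\mathcal A,\mathcal B,\mathcal F)\in\mathcal{BV}(\Omega)$ and every pair $S=(\varphi,\psi)$ with $\varphi,\psi\in C^1(\Omega;\mathbb C)$ and $|\varphi|>|\psi|$ pointwise on $\Omega$, the pipeline normal form $D_S:=\pi(S^\sharp D)=(\mu_S,\mathcal A_S,\mathcal B_S,\mathcal F_S)$ of the substituted real system $S^\sharp D$ satisfies $$D_S=\tilde\varphi\cdot D,\qquad \tilde\varphi=\frac{-i\lambda}{\varphi-\psi}\in C^1(\Omega;\mathbb C^* ),$$ where $\lambda=i(1+\mu)/(1-\mu)$, which takes values in the open upper half-plane, is the spectral root of $D$, and $\tilde\varphi\cdot D$ denotes the gauge action. In particular $\mu_S=\mu$, $|\mathcal B_S|=|\mathcal B|$, and $\Theta_{D_S}=\Theta_D$ pointwise.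
   Context: **Notation.** $z=x+iy$, $\partial_z=\frac12(\partial_x-i\partial_y)$, $\partial_{\bar z}=\frac12(\partial_x+i\partial_y)$, $\mathbb C^*=\mathbb C\setminus\{0\}$, $\mathbb H^+=\{\operatorname{Im}>0\}$. **BV data.** $\mathcal{BV}(\Omega)$ is the set of quadruples $D=(\mu,\mathcal A,\mathcal B,\mathcal F)$ with $\mu\in C^1(\Omega;\mathbb C)$, $|\mu|<1$ pointwise, and $\mathcal A,\mathcal B,\mathcal F\in C^0(\Omega;\mathbb C)$. The BV equation of $D$ is $\mathrm{Res}_D(w)=0$, where $\mathrm{Res}_D(w):=w_{\bar z}-\mu w_z+\mathcal Aw+\mathcal B\bar w-\mathcal F$. The density of $D$ is $\Theta_D=\frac{|\mathcal B|^2}{1-|\mu|^2}\,dx\,dy$. **Gauge action.** For $\phi\in C^1(\Omega;\mathbb C^* )$, $\phi\cdot D:=(\mu',\mathcal A',\mathcal B',\mathcal F')$ with $\mu'=\mu$, $\mathcal A'=\mathcal A-\frac{\phi_{\bar z}}{\phi}+\mu\frac{\phi_z}{\phi}$, $\mathcal B'=\mathcal B\,\frac{\phi}{\bar\phi}$, $\mathcal F'=\phi\,\mathcal F$. **Substitution.** $S^\sharp D$ is the real first-order $2\times2$ system in real unknowns $(u',v'')$ obtained by substituting $w=\varphi\,v'+\psi\,\overline{v'}$, $v'=u'+iv''$, into the equation $\mathrm{Res}_D(w)=0$ and separating real and imaginary parts (unknowns ordered as (real part, imaginary part); they play the roles of $(u,v)$ below). **Admissible systems and skeleton form.** A real first-order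 system in real unknowns $(u,v)$ is in skeleton form if it reads $$-v_y+a_{11}u_x+a_{12}u_y+a_{13}u+a_{14}v=f_1,\qquad v_x+a_{21}u_x+a_{22}u_y+a_{23}u+a_{24}v=f_2,$$ with $a_{i1},a_{i2}\in C^1(\Omega)$, $a_{i3},a_{i4},f_i\in C^0(\Omega)$ real, and ellipticity $a_{11}>0$, $a_{11}a_{22}-\frac14(a_{12}+a_{21})^2>0$. A system is admissible if it is brought to such a form by left multiplication by some $M\in C^0(\Omega;\mathrm{GL}(2,\mathbb R))$ (this $M$ is then unique; this step is part of the pipeline). **Pipeline $\pi$.** For an admissible system put in skeleton form, set $\alpha=a_{22}/a_{11}$, $\beta=-(a_{12}+a_{21})/a_{11}$, $\lambda=\frac12(-\beta+i\sqrt{4\alpha-\beta^2})\in\mathbb H^+$ (spectral root: $\lambda^2+\beta\lambda+\alpha=0$), $\mu=(\lambda-i)/(\lambda+i)$. With $U=a_{22}u$, $V=v-a_{12}u$, multiplying the first equation by $\alpha$, and adding $\beta$ times the first skeleton equation to the second, one gets the canonical form $U_x-\alpha V_y+aU+bV=f$, $V_x+U_y-\beta V_y+cU+dV=g$, where $a=\frac{-(a_{22})_x-\alpha (a_{12})_y+\alpha a_{13}+\alpha a_{14}a_{12}}{a_{22}}$, $b=\alpha a_{14}$, $c=\frac{(a_{12})_x-(a_{22})_y-\beta(a_{12})_y+a_{23}+\beta a_{13}+a_{12}(a_{24}+\beta a_{14})}{a_{22}}$, $d=a_{24}+\beta a_{14}$, $f=\alpha f_1$, $g=f_2+\beta f_1$.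 Let $G_1,G_2$ be the real functions with $\lambda_x+\lambda\lambda_y=G_1+G_2\lambda$, and $\tilde b=b-G_1$, $\tilde d=d-G_2$. Let $A_\lambda,B_\lambda$ be the unique complex functions with $A_\lambda(U+\lambda V)+B_\lambda(U+\bar\lambda V)=\frac12[(aU+\tilde bV)+\lambda(cU+\tilde dV)]$ for all real $U,V$, and $F_\lambda=\frac12(f+\lambda g)$. Then $\pi$ of the system is $(\mu,(1-\mu)A_\lambda,(1-\mu)B_\lambda,(1-\mu)F_\lambda)\in\mathcal{BV}(\Omega)$, whose complex unknown is $w=U+\lambda V$. (The system $S^\sharp D$ is admissible.) *)

(* Defs.v *)
From Stdlib Require Import Reals.
From Coquelicot Require Import Coquelicot.

Set Implicit Arguments.
Open Scope R_scope.

Notation plane := (R * R)%type.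

Definition connected (Om : plane -> Prop) : Prop :=
  forall P Q : plane -> Prop, open P -> open Q ->
    (forall p, Om p -> P p \/ Q p) ->
    (exists p, Om p /\ P p) -> (exists p, Om p /\ Q p) ->
    exists p, Om p /\ P p /\ Q p.

Definition is_domain (Om : plane -> Prop) : Prop :=
  open Om /\ connected Om /\ exists p, Om p.

(** Functions on [Om] are represented by total functions on the plane of which
    only the values on the open set [Om] matter: regularity and equality are
    always asserted on [Om] only. *)

Definition dx (f : plane -> R) (p : plane) : R :=
  Derive (fun t => f (t, snd p)) (fst p).
Definition dy (f : plane -> R) (p : plane) : R :=
  Derive (fun t => f (fst p, t)) (snd p).

Definition C0_on (Om : plane -> Prop) (f : plane -> R) : Prop :=
  forall p, Om p -> continuous f p.

Definition C1_on (Om : plane -> Prop) (f : plane -> R) : Prop :=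
  C0_on Om f /\
  (forall p, Om p ->
     ex_derive (fun t => f (t, snd p)) (fst p) /\
     ex_derive (fun t => f (fst p, t)) (snd p)) /\
  C0_on Om (dx f) /\ C0_on Om (dy f).

Definition CC0_on (Om : plane -> Prop) (f : plane -> C) : Prop :=
  C0_on Om (fun p => Re (f p)) /\ C0_on Om (fun p => Im (f p)).

Definition CC1_on (Om : plane -> Prop) (f : plane -> C) : Prop :=
  C1_on Om (fun p => Re (f p)) /\ C1_on Om (fun p => Im (f p)).

Definition Cdx (f : plane -> C) (p : plane) : C :=
  (dx (fun q => Re (f q)) p, dx (fun q => Im (f q)) p).
Definition Cdy (f : plane -> C) (p : plane) : C :=
  (dy (fun q => Re (f q)) p, dy (fun q => Im (f q)) p).

Definition dz (f : plane -> C) (p : plane) : C :=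
  (/ 2 * (Cdx f p - Ci * Cdy f p))%C.
Definition dzbar (f : plane -> C) (p : plane) : C :=
  (/ 2 * (Cdx f p + Ci * Cdy f p))%C.

Record bv_data := BVData {
  bv_mu : plane -> C;
  bv_A : plane -> C;
  bv_B : plane -> C;
  bv_F : plane -> C }.

Definition BV (Om : plane -> Prop) (D : bv_data) : Prop :=
  CC1_on Om (bv_mu D) /\ (forall p, Om p -> Cmod (bv_mu D p) < 1) /\
  CC0_on Om (bv_A D) /\ CC0_on Om (bv_B D) /\ CC0_on Om (bv_F D).

Definition bv_eq (Om : plane -> Prop) (D E : bv_data) : Prop :=
  forall p, Om p ->
    bv_mu D p = bv_mu E p /\ bv_A D p = bv_A E p /\
    bv_B D p = bv_B E p /\ bv_F D p = bv_F E p.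

Definition Res (D : bv_data) (w : plane -> C) (p : plane) : C :=
  (dzbar w p - bv_mu D p * dz w p + bv_A D p * w p
   + bv_B D p * Cconj (w p) - bv_F D p)%C.

(** Coefficient of the 2-form [dx dy] in the density Theta_D. *)
Definition density (D : bv_data) (p : plane) : R :=
  Cmod (bv_B D p) ^ 2 / (1 - Cmod (bv_mu D p) ^ 2).

Definition gauge (phi : plane -> C) (D : bv_data) : bv_data :=
  BVData
    (bv_mu D)
    (fun p => bv_A D p - dzbar phi p / phi p
              + bv_mu D p * (dz phi p / phi p))%C
    (fun p => bv_B D p * (phi p / Cconj (phi p)))%C
    (fun p => phi p * bv_F D p)%C.

Definition spectral_root (D : bv_data) (p : plane) : C :=
  (Ci * (1 + bv_mu D p) / (1 - bv_mu D p))%C.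

(** [c_ux u_x + c_uy u_y + c_vx v_x + c_vy v_y + c_u u + c_v v = rhs] *)
Record equation := Equation {
  c_ux : plane -> R; c_uy : plane -> R;
  c_vx : plane -> R; c_vy : plane -> R;
  c_u : plane -> R; c_v : plane -> R;
  rhs : plane -> R }.

Record system := System { eqn1 : equation; eqn2 : equation }.

Definition residual (E : equation) (u v : plane -> R) (p : plane) : R :=
  c_ux E p * dx u p + c_uy E p * dy u p + c_vx E p * dx v p + c_vy E p * dy v p
  + c_u E p * u p + c_v E p * v p - rhs E p.

Definition equation_eq (Om : plane -> Prop) (E E' : equation) : Prop :=
  forall p, Om p ->
    c_ux E p = c_ux E' p /\ c_uy E p = c_uy E' p /\
    c_vx E p = c_vx E' p /\ c_vy E p = c_vy E' p /\
    c_u E p = c_u E' p /\ c_v E p = c_v E' p /\ rhs E p = rhs E' p.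

Definition system_eq (Om : plane -> Prop) (T T' : system) : Prop :=
  equation_eq Om (eqn1 T) (eqn1 T') /\ equation_eq Om (eqn2 T) (eqn2 T').

(** Testing on all C^1 unknowns [(u, v)] determines the coefficients and
    right-hand sides of [T] on [Om]. *)
Definition is_substituted (Om : plane -> Prop) (D : bv_data)
    (phi psi : plane -> C) (T : system) : Prop :=
  forall u v : plane -> R, C1_on Om u -> C1_on Om v ->
    let v' := fun q => (u q, v q) : C in
    let w := fun q => (phi q * v' q + psi q * Cconj (v' q))%C in
    forall p, Om p ->
      residual (eqn1 T) u v p = Re (Res D w p) /\
      residual (eqn2 T) u v p = Im (Res D w p).

Record matrix_field := MatrixField {
  m11 : plane -> R; m12 : plane -> R;
  m21 : plane -> R; m22 : plane -> R }.

Definition C0_GL2 (Om : plane -> Prop) (M : matrix_field) : Prop :=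
  C0_on Om (m11 M) /\ C0_on Om (m12 M) /\
  C0_on Om (m21 M) /\ C0_on Om (m22 M) /\
  (forall p, Om p -> m11 M p * m22 M p - m12 M p * m21 M p <> 0).

Definition lin_comb (r s : plane -> R) (E E' : equation) : equation :=
  Equation
    (fun p => r p * c_ux E p + s p * c_ux E' p)
    (fun p => r p * c_uy E p + s p * c_uy E' p)
    (fun p => r p * c_vx E p + s p * c_vx E' p)
    (fun p => r p * c_vy E p + s p * c_vy E' p)
    (fun p => r p * c_u E p + s p * c_u E' p)
    (fun p => r p * c_v E p + s p * c_v E' p)
    (fun p => r p * rhs E p + s p * rhs E' p).

Definition left_mul (M : matrix_field) (T : system) : system :=
  System (lin_comb (m11 M) (m12 M) (eqn1 T) (eqn2 T))
         (lin_comb (m21 M) (m22 M) (eqn1 T) (eqn2 T)).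

Record skeleton := Skeleton {
  a11 : plane -> R; a12 : plane -> R; a13 : plane -> R; a14 : plane -> R;
  a21 : plane -> R; a22 : plane -> R; a23 : plane -> R; a24 : plane -> R;
  f1 : plane -> R; f2 : plane -> R }.

Definition is_skeleton (Om : plane -> Prop) (K : skeleton) : Prop :=
  (C1_on Om (a11 K) /\ C1_on Om (a12 K) /\
   C1_on Om (a21 K) /\ C1_on Om (a22 K)) /\
  (C0_on Om (a13 K) /\ C0_on Om (a14 K) /\
   C0_on Om (a23 K) /\ C0_on Om (a24 K) /\
   C0_on Om (f1 K) /\ C0_on Om (f2 K)) /\
  (forall p, Om p ->
     0 < a11 K p /\
     0 < a11 K p * a22 K p - / 4 * (a12 K p + a21 K p) ^ 2).

Definition skeleton_system (K : skeleton) : system :=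
  System
    (Equation (a11 K) (a12 K) (fun _ => 0) (fun _ => -1) (a13 K) (a14 K) (f1 K))
    (Equation (a21 K) (a22 K) (fun _ => 1) (fun _ => 0) (a23 K) (a24 K) (f2 K)).

Definition has_skeleton (Om : plane -> Prop) (T : system) (K : skeleton)
    : Prop :=
  is_skeleton Om K /\
  exists M : matrix_field,
    C0_GL2 Om M /\ system_eq Om (left_mul M T) (skeleton_system K).

Definition admissible (Om : plane -> Prop) (T : system) : Prop :=
  exists K : skeleton, has_skeleton Om T K.

Definition k_alpha (K : skeleton) (p : plane) : R := a22 K p / a11 K p.
Definition k_beta (K : skeleton) (p : plane) : R :=
  - (a12 K p + a21 K p) / a11 K p.
Definition k_lambda (K : skeleton) (p : plane) : C :=
  (/ 2 * (- k_beta K p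
          + Ci * sqrt (4 * k_alpha K p - k_beta K p ^ 2)%R))%C.
Definition k_mu (K : skeleton) (p : plane) : C :=
  ((k_lambda K p - Ci) / (k_lambda K p + Ci))%C.

(** Coefficients of the canonical form
    [U_x - alpha V_y + a U + b V = f],
    [V_x + U_y - beta V_y + c U + d V = g],
    where [U = a22 u] and [V = v - a12 u]. *)
Definition k_a (K : skeleton) (p : plane) : R :=
  (- dx (a22 K) p - k_alpha K p * dy (a12 K) p + k_alpha K p * a13 K p
   + k_alpha K p * a14 K p * a12 K p) / a22 K p.
Definition k_b (K : skeleton) (p : plane) : R := k_alpha K p * a14 K p.
Definition k_c (K : skeleton) (p : plane) : R :=
  (dx (a12 K) p - dy (a22 K) p - k_beta K p * dy (a12 K) p + a23 K p
   + k_beta K p * a13 K p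
   + a12 K p * (a24 K p + k_beta K p * a14 K p)) / a22 K p.
Definition k_d (K : skeleton) (p : plane) : R :=
  a24 K p + k_beta K p * a14 K p.
Definition k_f (K : skeleton) (p : plane) : R := k_alpha K p * f1 K p.
Definition k_g (K : skeleton) (p : plane) : R := f2 K p + k_beta K p * f1 K p.

Definition skeleton_normal_form (Om : plane -> Prop) (K : skeleton)
    (D : bv_data) : Prop :=
  exists (G1 G2 : plane -> R) (Al Bl : plane -> C),
    (forall p, Om p ->
       (Cdx (k_lambda K) p + k_lambda K p * Cdy (k_lambda K) p
        = G1 p + G2 p * k_lambda K p)%C) /\
    (forall p, Om p -> forall U V : R,
       (Al p * (U + k_lambda K p * V) + Bl p * (U + Cconj (k_lambda K p) * V)
        = / 2 * ((k_a K p * U + (k_b K p - G1 p) * V)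
                 + k_lambda K p * (k_c K p * U + (k_d K p - G2 p) * V)))%C) /\
    bv_eq Om D
      (BVData
         (k_mu K)
         (fun p => (1 - k_mu K p) * Al p)%C
         (fun p => (1 - k_mu K p) * Bl p)%C
         (fun p => (1 - k_mu K p) * (/ 2 * (k_f K p + k_lambda K p * k_g K p)))%C).

Definition pipeline (Om : plane -> Prop) (T : system) (D : bv_data) : Prop :=
  exists K : skeleton, has_skeleton Om T K /\ skeleton_normal_form Om K D.

(* Main.v *)
(** Write [lam] for the spectral root and [w = P u + Q v], with [P = phi + psi] and
    [Q = i (phi - psi)].  Since [2 (w_zbar - mu w_z) = (1 - mu) (w_x + lam w_y)], dividing
    the complex equation by its coefficient of [v_x] shows that the skeleton coefficients
    are exactly the real solutions of [a_2j - lam a_1j = (complex coefficient j) / (v_x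
    coefficient)]; testing against affine unknowns recovers the complex coefficients from
    the substituted system.  In particular the spectral root of the skeleton is again
    [lam], and [a22 - lam a12 = lam P / Q], so the pipeline unknown is
    [U + lam V = (lam / Q) w = gam w] with [gam = - i lam / (phi - psi)].  The canonical
    form is [lam / Q] times the original complex equation, i.e. the equation satisfied by
    [gam w], and the product rule for [d_x + lam d_y] yields the gauge action of [gam]. *)

Require Import Defs.
From Stdlib Require Import Reals Lra.
From Coquelicot Require Import Coquelicot.
Open Scope R_scope.

(** * Regularity calculus *)

(** Partial derivatives are taken along horizontal and vertical lines, so facts on a planar
    neighbourhood have to be restricted to such lines. *)
Lemma locally_slice_x (Q : plane -> Prop) (p : plane) :
  locally p Q -> locally (fst p) (fun t => Q (t, snd p)).
Proof.
  intros [e He]. exists e. intros t Ht. apply He. split; [exact Ht | apply ball_center].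
Qed.

Lemma locally_slice_y (Q : plane -> Prop) (p : plane) :
  locally p Q -> locally (snd p) (fun t => Q (fst p, t)).
Proof.
  intros [e He]. exists e. intros t Ht. apply He. split; [apply ball_center | exact Ht].
Qed.

Section OpenSet.

Context (Om : plane -> Prop) (oOm : open Om).

Lemma locally_eq_on (T : Type) (f g : plane -> T) (p : plane) :
  (forall q, Om q -> f q = g q) -> Om p -> locally p (fun q => f q = g q).
Proof.
  intros E Hp. apply filter_imp with (2 := oOm p Hp). exact E.
Qed.

(** Functions are total but compared only on [Om]; as [Om] is open, equality there already holds on
    a neighbourhood of [p], hence fixes the derivative. *)
Lemma dx_ext_on (f g : plane -> R) (p : plane) :
  (forall q, Om q -> f q = g q) -> Om p -> dx f p = dx g p.
Proof.
  intros E Hp. apply Derive_ext_loc.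
  apply (locally_slice_x (fun q => f q = g q)). now apply locally_eq_on.
Qed.

Lemma dy_ext_on (f g : plane -> R) (p : plane) :
  (forall q, Om q -> f q = g q) -> Om p -> dy f p = dy g p.
Proof.
  intros E Hp. apply Derive_ext_loc.
  apply (locally_slice_y (fun q => f q = g q)). now apply locally_eq_on.
Qed.

Lemma C0_ext_on (f g : plane -> R) :
  (forall q, Om q -> f q = g q) -> C0_on Om f -> C0_on Om g.
Proof.
  intros E H p Hp. apply continuous_ext_loc with (2 := H p Hp). now apply locally_eq_on.
Qed.

Lemma C1_ext_on (f g : plane -> R) :
  (forall q, Om q -> f q = g q) -> C1_on Om f -> C1_on Om g.
Proof.
  intros E (H0 & H1 & Hx & Hy). split; [| split; [| split]].
  - now apply C0_ext_on with (2 := H0).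
  - intros p Hp. destruct (H1 p Hp) as [ex ey]. split.
    + apply ex_derive_ext_loc with (2 := ex).
      apply (locally_slice_x (fun q => f q = g q)). now apply locally_eq_on.
    + apply ex_derive_ext_loc with (2 := ey).
      apply (locally_slice_y (fun q => f q = g q)). now apply locally_eq_on.
  - apply C0_ext_on with (2 := Hx). intros; now apply dx_ext_on.
  - apply C0_ext_on with (2 := Hy). intros; now apply dy_ext_on.
Qed.

(** * Algebra of continuous and $C^1$ real functions *)

Lemma C0_const (c : R) : C0_on Om (fun _ => c).
Proof. intros p _. apply continuous_const. Qed.

Lemma C0_plus (f g : plane -> R) :
  C0_on Om f -> C0_on Om g -> C0_on Om (fun p => f p + g p).
Proof. intros Hf Hg p Hp. exact (continuous_plus f g p (Hf p Hp) (Hg p Hp)). Qed.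

Lemma C0_opp (f : plane -> R) : C0_on Om f -> C0_on Om (fun p => - f p).
Proof. intros Hf p Hp. exact (continuous_opp f p (Hf p Hp)). Qed.

Lemma C0_minus (f g : plane -> R) :
  C0_on Om f -> C0_on Om g -> C0_on Om (fun p => f p - g p).
Proof. intros. now apply C0_plus; [| apply C0_opp]. Qed.

Lemma C0_mult (f g : plane -> R) :
  C0_on Om f -> C0_on Om g -> C0_on Om (fun p => f p * g p).
Proof. intros Hf Hg p Hp. exact (continuous_mult f g p (Hf p Hp) (Hg p Hp)). Qed.

Lemma C0_inv (f : plane -> R) :
  (forall p, Om p -> f p <> 0) -> C0_on Om f -> C0_on Om (fun p => / f p).
Proof.
  intros Hn Hf p Hp. apply (continuous_comp f Rinv).
  - exact (Hf p Hp).
  - apply (continuous_Rinv_comp (fun x => x)); [apply continuous_id | exact (Hn p Hp)].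
Qed.

Lemma C1_C0 (f : plane -> R) : C1_on Om f -> C0_on Om f.
Proof. now intros []. Qed.

Lemma dx_plus (f g : plane -> R) (p : plane) :
  C1_on Om f -> C1_on Om g -> Om p -> dx (fun q => f q + g q) p = dx f p + dx g p.
Proof.
  intros (_ & Hf & _) (_ & Hg & _) Hp.
  exact (Derive_plus _ _ _ (proj1 (Hf p Hp)) (proj1 (Hg p Hp))).
Qed.

Lemma dy_plus (f g : plane -> R) (p : plane) :
  C1_on Om f -> C1_on Om g -> Om p -> dy (fun q => f q + g q) p = dy f p + dy g p.
Proof.
  intros (_ & Hf & _) (_ & Hg & _) Hp.
  exact (Derive_plus _ _ _ (proj2 (Hf p Hp)) (proj2 (Hg p Hp))).
Qed.

Lemma dx_opp (f : plane -> R) (p : plane) : dx (fun q => - f q) p = - dx f p.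
Proof. exact (Derive_opp (fun t => f (t, snd p)) (fst p)). Qed.

Lemma dy_opp (f : plane -> R) (p : plane) : dy (fun q => - f q) p = - dy f p.
Proof. exact (Derive_opp (fun t => f (fst p, t)) (snd p)). Qed.

Lemma dx_mult (f g : plane -> R) (p : plane) :
  C1_on Om f -> C1_on Om g -> Om p ->
  dx (fun q => f q * g q) p = dx f p * g p + f p * dx g p.
Proof.
  intros (_ & Hf & _) (_ & Hg & _) Hp. destruct p as [x y].
  exact (Derive_mult _ _ _ (proj1 (Hf _ Hp)) (proj1 (Hg _ Hp))).
Qed.

Lemma dy_mult (f g : plane -> R) (p : plane) :
  C1_on Om f -> C1_on Om g -> Om p ->
  dy (fun q => f q * g q) p = dy f p * g p + f p * dy g p.
Proof.
  intros (_ & Hf & _) (_ & Hg & _) Hp. destruct p as [x y].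
  exact (Derive_mult _ _ _ (proj2 (Hf _ Hp)) (proj2 (Hg _ Hp))).
Qed.

Lemma C1_plus (f g : plane -> R) :
  C1_on Om f -> C1_on Om g -> C1_on Om (fun p => f p + g p).
Proof.
  intros Hf Hg. pose proof Hf as (Hf0 & Hf1 & Hfx & Hfy).
  pose proof Hg as (Hg0 & Hg1 & Hgx & Hgy). split; [| split; [| split]].
  - now apply C0_plus.
  - intros p Hp. destruct (Hf1 p Hp), (Hg1 p Hp).
    split; apply (ex_derive_plus (V := R_NormedModule)); assumption.
  - apply C0_ext_on with (fun q => dx f q + dx g q); [| now apply C0_plus].
    intros q Hq. symmetry. now apply dx_plus.
  - apply C0_ext_on with (fun q => dy f q + dy g q); [| now apply C0_plus].
    intros q Hq. symmetry. now apply dy_plus.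
Qed.

Lemma C1_opp (f : plane -> R) : C1_on Om f -> C1_on Om (fun p => - f p).
Proof.
  intros (Hf0 & Hf1 & Hfx & Hfy). split; [| split; [| split]].
  - now apply C0_opp.
  - intros p Hp. destruct (Hf1 p Hp).
    split; apply (ex_derive_opp (V := R_NormedModule)); assumption.
  - apply C0_ext_on with (fun q => - dx f q); [| now apply C0_opp].
    intros q _. symmetry. apply dx_opp.
  - apply C0_ext_on with (fun q => - dy f q); [| now apply C0_opp].
    intros q _. symmetry. apply dy_opp.
Qed.

Lemma C1_minus (f g : plane -> R) :
  C1_on Om f -> C1_on Om g -> C1_on Om (fun p => f p - g p).
Proof. intros. now apply C1_plus; [| apply C1_opp]. Qed.

Lemma C1_mult (f g : plane -> R) :
  C1_on Om f -> C1_on Om g -> C1_on Om (fun p => f p * g p).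
Proof.
  intros Hf Hg. pose proof Hf as (Hf0 & Hf1 & Hfx & Hfy).
  pose proof Hg as (Hg0 & Hg1 & Hgx & Hgy). split; [| split; [| split]].
  - now apply C0_mult.
  - intros p Hp. destruct (Hf1 p Hp), (Hg1 p Hp). split; apply ex_derive_mult; assumption.
  - apply C0_ext_on with (fun q => dx f q * g q + f q * dx g q);
      [| now apply C0_plus; apply C0_mult].
    intros q Hq. symmetry. now apply dx_mult.
  - apply C0_ext_on with (fun q => dy f q * g q + f q * dy g q);
      [| now apply C0_plus; apply C0_mult].
    intros q Hq. symmetry. now apply dy_mult.
Qed.

Lemma C1_inv (f : plane -> R) :
  (forall p, Om p -> f p <> 0) -> C1_on Om f -> C1_on Om (fun p => / f p).
Proof.
  intros Hn (Hf0 & Hf1 & Hfx & Hfy).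
  assert (Hi : C0_on Om (fun p => / f p)) by now apply C0_inv.
  split; [exact Hi | split; [| split]].
  - intros [x y] Hp. destruct (Hf1 _ Hp) as [ex ey]. split.
    + apply (ex_derive_inv (fun t => f (t, y))); [exact ex | exact (Hn _ Hp)].
    + apply (ex_derive_inv (fun t => f (x, t))); [exact ey | exact (Hn _ Hp)].
  - apply C0_ext_on with (fun q => - (dx f q * (/ f q * / f q)));
      [| now apply C0_opp, C0_mult, C0_mult].
    intros [x y] Hq. pose proof (Hn _ Hq). unfold dx; simpl.
    rewrite (Derive_inv (fun t => f (t, y))); [| apply (Hf1 _ Hq) | assumption].
    now field.
  - apply C0_ext_on with (fun q => - (dy f q * (/ f q * / f q)));
      [| now apply C0_opp, C0_mult, C0_mult].
    intros [x y] Hq. pose proof (Hn _ Hq). unfold dy; simpl.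
    rewrite (Derive_inv (fun t => f (x, t))); [| apply (Hf1 _ Hq) | assumption].
    now field.
Qed.

(** * Affine test functions, which realise every 1-jet at a point *)

Lemma dx_affine (a b c : R) (p q : plane) :
  dx (fun r => a + b * (fst r - fst p) + c * (snd r - snd p)) q = b.
Proof. apply is_derive_unique; simpl. auto_derive; [exact I | ring]. Qed.

Lemma dy_affine (a b c : R) (p q : plane) :
  dy (fun r => a + b * (fst r - fst p) + c * (snd r - snd p)) q = c.
Proof. apply is_derive_unique; simpl. auto_derive; [exact I | ring]. Qed.

Lemma C1_affine (a b c : R) (p : plane) :
  C1_on Om (fun q => a + b * (fst q - fst p) + c * (snd q - snd p)).
Proof.
  split; [| split; [| split]].
  - apply C0_plus; [apply C0_plus; [apply C0_const |] |]; apply C0_mult;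
      try apply C0_const; apply C0_minus; try apply C0_const; intros [x y] _;
      [apply (continuous_fst x y) | apply (continuous_snd x y)].
  - intros q _; split; simpl; auto_derive; exact I.
  - apply C0_ext_on with (fun _ => b); [| apply C0_const].
    intros; symmetry; apply dx_affine.
  - apply C0_ext_on with (fun _ => c); [| apply C0_const].
    intros; symmetry; apply dy_affine.
Qed.

Lemma C1_const (c : R) : C1_on Om (fun _ => c).
Proof.
  apply C1_ext_on with (2 := C1_affine c 0 0 (0, 0)). intros; ring.
Qed.

(** * Complex-valued functions, treated componentwise *)

Lemma CC0_const (c : C) : CC0_on Om (fun _ => c).
Proof. split; apply C0_const. Qed.

Lemma CC0_plus (f g : plane -> C) :
  CC0_on Om f -> CC0_on Om g -> CC0_on Om (fun p => f p + g p)%C.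
Proof. intros [] []; split; now apply C0_plus. Qed.

Lemma CC0_opp (f : plane -> C) : CC0_on Om f -> CC0_on Om (fun p => - f p)%C.
Proof. intros []; split; now apply C0_opp. Qed.

Lemma CC0_minus (f g : plane -> C) :
  CC0_on Om f -> CC0_on Om g -> CC0_on Om (fun p => f p - g p)%C.
Proof. intros. now apply CC0_plus; [| apply CC0_opp]. Qed.

Lemma CC0_mult (f g : plane -> C) :
  CC0_on Om f -> CC0_on Om g -> CC0_on Om (fun p => f p * g p)%C.
Proof.
  intros [] []; split; [apply C0_minus | apply C0_plus]; now apply C0_mult.
Qed.

Lemma CC0_conj (f : plane -> C) : CC0_on Om f -> CC0_on Om (fun p => Cconj (f p)).
Proof. intros []; split; [assumption | now apply C0_opp]. Qed.

Lemma CC1_CC0 (f : plane -> C) : CC1_on Om f -> CC0_on Om f.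
Proof. intros []; split; now apply C1_C0. Qed.

Lemma CC0_Cdx (f : plane -> C) : CC1_on Om f -> CC0_on Om (Cdx f).
Proof. intros [(_ & _ & ? & _) (_ & _ & ? & _)]. now split. Qed.

Lemma CC0_Cdy (f : plane -> C) : CC1_on Om f -> CC0_on Om (Cdy f).
Proof. intros [(_ & _ & _ & ?) (_ & _ & _ & ?)]. now split. Qed.

Lemma CC0_ext_on (f g : plane -> C) :
  (forall q, Om q -> f q = g q) -> CC0_on Om f -> CC0_on Om g.
Proof.
  intros E [H1 H2]; split; [apply C0_ext_on with (2 := H1) | apply C0_ext_on with (2 := H2)];
    intros q Hq; now rewrite E.
Qed.

Lemma CC1_ext_on (f g : plane -> C) :
  (forall q, Om q -> f q = g q) -> CC1_on Om f -> CC1_on Om g.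
Proof.
  intros E [H1 H2]; split; [apply C1_ext_on with (2 := H1) | apply C1_ext_on with (2 := H2)];
    intros q Hq; now rewrite E.
Qed.

Lemma CC1_const (c : C) : CC1_on Om (fun _ => c).
Proof. split; apply C1_const. Qed.

Lemma CC1_RtoC (f : plane -> R) : C1_on Om f -> CC1_on Om (fun p => RtoC (f p)).
Proof. intros H. split; [exact H | exact (C1_const 0)]. Qed.

Lemma CC1_plus (f g : plane -> C) :
  CC1_on Om f -> CC1_on Om g -> CC1_on Om (fun p => f p + g p)%C.
Proof. intros [] []; split; now apply C1_plus. Qed.

Lemma CC1_opp (f : plane -> C) : CC1_on Om f -> CC1_on Om (fun p => - f p)%C.
Proof. intros []; split; now apply C1_opp. Qed.

Lemma CC1_minus (f g : plane -> C) :
  CC1_on Om f -> CC1_on Om g -> CC1_on Om (fun p => f p - g p)%C.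
Proof. intros. now apply CC1_plus; [| apply CC1_opp]. Qed.

Lemma CC1_mult (f g : plane -> C) :
  CC1_on Om f -> CC1_on Om g -> CC1_on Om (fun p => f p * g p)%C.
Proof.
  intros [] []; split; [apply C1_minus | apply C1_plus]; now apply C1_mult.
Qed.

Lemma norm2_pos (z : C) : z <> 0 -> 0 < Re z ^ 2 + Im z ^ 2.
Proof.
  intros Hz. apply Cmod_gt_0 in Hz. apply Rnot_le_lt. intros H.
  unfold Cmod in Hz. rewrite sqrt_neg_0 in Hz by exact H. lra.
Qed.

(** The components of $1/z$ are $\operatorname{Re}z/|z|^2$ and $-\operatorname{Im}z/|z|^2$, so the
    real inverse of $|z|^2$ suffices. *)
Lemma CC1_inv (f : plane -> C) :
  (forall p, Om p -> f p <> 0) -> CC1_on Om f -> CC1_on Om (fun p => / f p)%C.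
Proof.
  intros Hn [Hr Hi].
  assert (HN : C1_on Om (fun p => / (Re (f p) ^ 2 + Im (f p) ^ 2))).
  { apply C1_inv.
    - intros p Hp. apply Rgt_not_eq, norm2_pos. now apply Hn.
    (* The square [x ^ 2] unfolds to [x * (x * 1)], whence the product with a constant function. *)
    - apply C1_plus; apply C1_mult; try assumption; (apply C1_mult; [assumption | apply C1_const]). }
  split.
  - now apply C1_mult.
  - now apply C1_mult; [apply C1_opp |].
Qed.

Lemma CC1_div (f g : plane -> C) :
  (forall p, Om p -> g p <> 0) -> CC1_on Om f -> CC1_on Om g ->
  CC1_on Om (fun p => f p / g p)%C.
Proof. intros. now apply CC1_mult; [| apply CC1_inv]. Qed.

Lemma CC0_inv (f : plane -> C) :
  (forall p, Om p -> f p <> 0) -> CC0_on Om f -> CC0_on Om (fun p => / f p)%C.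
Proof.
  intros Hn [Hr Hi].
  assert (HN : C0_on Om (fun p => / (Re (f p) ^ 2 + Im (f p) ^ 2))).
  { apply C0_inv.
    - intros p Hp. apply Rgt_not_eq, norm2_pos. now apply Hn.
    - apply C0_plus; apply C0_mult; try assumption; (apply C0_mult; [assumption | apply C0_const]). }
  split.
  - now apply C0_mult.
  - now apply C0_mult; [apply C0_opp |].
Qed.

Lemma CC0_div (f g : plane -> C) :
  (forall p, Om p -> g p <> 0) -> CC0_on Om f -> CC0_on Om g ->
  CC0_on Om (fun p => f p / g p)%C.
Proof. intros. now apply CC0_mult; [| apply CC0_inv]. Qed.

Lemma Cdx_ext_on (f g : plane -> C) (p : plane) :
  (forall q, Om q -> f q = g q) -> Om p -> Cdx f p = Cdx g p.
Proof.
  intros E Hp. unfold Cdx. f_equal; apply dx_ext_on; trivial; intros; now rewrite E.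
Qed.

Lemma Cdy_ext_on (f g : plane -> C) (p : plane) :
  (forall q, Om q -> f q = g q) -> Om p -> Cdy f p = Cdy g p.
Proof.
  intros E Hp. unfold Cdy. f_equal; apply dy_ext_on; trivial; intros; now rewrite E.
Qed.

(** The operator $\partial_x+l\,\partial_y$. With [l] the spectral root it is the principal part of
    the complex equation, up to a nonvanishing factor. *)
Definition along (l f : plane -> C) (p : plane) : C := (Cdx f p + l p * Cdy f p)%C.

Lemma along_ext_on (l m f g : plane -> C) (p : plane) :
  (forall q, Om q -> l q = m q) -> (forall q, Om q -> f q = g q) -> Om p ->
  along l f p = along m g p.
Proof.
  intros E F Hp. unfold along.
  now rewrite (E p Hp), (Cdx_ext_on f g p F Hp), (Cdy_ext_on f g p F Hp).
Qed.

Lemma CC0_along (l f : plane -> C) :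
  CC0_on Om l -> CC1_on Om f -> CC0_on Om (along l f).
Proof.
  intros. apply CC0_plus; [now apply CC0_Cdx | apply CC0_mult; [assumption | now apply CC0_Cdy]].
Qed.

Lemma along_plus (l f g : plane -> C) (p : plane) :
  CC1_on Om f -> CC1_on Om g -> Om p ->
  along l (fun q => f q + g q)%C p = (along l f p + along l g p)%C.
Proof.
  intros [f1 f2] [g1 g2] Hp; unfold along, Cdx, Cdy, Re, Im in *; simpl.
  rewrite (dx_plus _ _ p f1 g1 Hp), (dx_plus _ _ p f2 g2 Hp).
  rewrite (dy_plus _ _ p f1 g1 Hp), (dy_plus _ _ p f2 g2 Hp).
  apply injective_projections; simpl; ring.
Qed.

Lemma along_mult (l f g : plane -> C) (p : plane) :
  CC1_on Om f -> CC1_on Om g -> Om p ->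
  along l (fun q => f q * g q)%C p = (along l f p * g p + f p * along l g p)%C.
Proof.
  intros [f1 f2] [g1 g2] Hp; unfold along, Cdx, Cdy, Re, Im in *; simpl.
  pose proof (C1_mult _ _ f1 g1) as h11. pose proof (C1_mult _ _ f1 g2) as h12.
  pose proof (C1_mult _ _ f2 g1) as h21. pose proof (C1_mult _ _ f2 g2) as h22.
  unfold Rminus.
  rewrite (dx_plus _ _ p h11 (C1_opp _ h22) Hp), (dy_plus _ _ p h11 (C1_opp _ h22) Hp),
    (dx_plus _ _ p h12 h21 Hp), (dy_plus _ _ p h12 h21 Hp), dx_opp, dy_opp.
  rewrite (dx_mult _ _ p f1 g1 Hp), (dx_mult _ _ p f1 g2 Hp), (dx_mult _ _ p f2 g1 Hp),
    (dx_mult _ _ p f2 g2 Hp), (dy_mult _ _ p f1 g1 Hp), (dy_mult _ _ p f1 g2 Hp),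
    (dy_mult _ _ p f2 g1 Hp), (dy_mult _ _ p f2 g2 Hp).
  apply injective_projections; simpl; ring.
Qed.

Lemma along_RtoC (l : plane -> C) (f : plane -> R) (p : plane) :
  along l (fun q => RtoC (f q)) p = (dx f p + l p * dy f p)%C.
Proof.
  unfold along, Cdx, Cdy, dx, dy; simpl. now rewrite !Derive_const.
Qed.

End OpenSet.

(** * Substituted systems and their skeleton forms *)

(** Packing the two real rows into one complex equation lets left multiplication by a real matrix be
    read as a real-linear map of $\mathbb C$. *)
Definition real_system (cux cuy cvx cvy cu cv r : plane -> C) : system :=
  System
    (Equation (fun p => Re (cux p)) (fun p => Re (cuy p)) (fun p => Re (cvx p))
       (fun p => Re (cvy p)) (fun p => Re (cu p)) (fun p => Re (cv p)) (fun p => Re (r p)))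
    (Equation (fun p => Im (cux p)) (fun p => Im (cuy p)) (fun p => Im (cvx p))
       (fun p => Im (cvy p)) (fun p => Im (cu p)) (fun p => Im (cv p)) (fun p => Im (r p))).

Lemma residual_real_system (cux cuy cvx cvy cu cv r : plane -> C) (u v : plane -> R)
    (p : plane) :
  let T := real_system cux cuy cvx cvy cu cv r in
  let z := (cux p * dx u p + cuy p * dy u p + cvx p * dx v p + cvy p * dy v p
            + cu p * u p + cv p * v p - r p)%C in
  residual (eqn1 T) u v p = Re z /\ residual (eqn2 T) u v p = Im z.
Proof. intros T z; unfold residual, T, z; split; simpl; unfold Re, Im; ring. Qed.

Lemma equation_eq_of_residual (Om : plane -> Prop) (E E' : equation) :
  open Om ->
  (forall u v, C1_on Om u -> C1_on Om v ->
     forall p, Om p -> residual E u v p = residual E' u v p) ->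
  equation_eq Om E E'.
Proof.
  intros oOm H p Hp.
  assert (J : forall a b c a' b' c' : R,
    c_ux E p * b + c_uy E p * c + c_vx E p * b' + c_vy E p * c'
      + c_u E p * a + c_v E p * a' - rhs E p =
    c_ux E' p * b + c_uy E' p * c + c_vx E' p * b' + c_vy E' p * c'
      + c_u E' p * a + c_v E' p * a' - rhs E' p).
  { intros a b c a' b' c'.
    specialize (H _ _ (C1_affine Om oOm a b c p) (C1_affine Om oOm a' b' c' p) p Hp).
    unfold residual in H. rewrite !dx_affine, !dy_affine in H.
    rewrite !Rminus_diag, !Rmult_0_r, !Rplus_0_r in H. exact H. }
  (* The zero jet isolates the right-hand side; each unit jet then isolates one coefficient. *)
  pose proof (J 0 0 0 0 0 0). pose proof (J 1 0 0 0 0 0). pose proof (J 0 1 0 0 0 0).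
  pose proof (J 0 0 1 0 0 0). pose proof (J 0 0 0 1 0 0). pose proof (J 0 0 0 0 1 0).
  pose proof (J 0 0 0 0 0 1). repeat split; lra.
Qed.

Lemma is_substituted_unique (Om : plane -> Prop) (D : bv_data) (phi psi : plane -> C)
    (T T' : system) :
  open Om -> is_substituted Om D phi psi T -> is_substituted Om D phi psi T' ->
  system_eq Om T T'.
Proof.
  intros oOm H H'. split; apply equation_eq_of_residual; trivial; intros u v Hu Hv p Hp;
    destruct (H u v Hu Hv p Hp) as [E1 E2]; destruct (H' u v Hu Hv p Hp) as [E1' E2'];
    congruence.
Qed.

Lemma system_eq_sym (Om : plane -> Prop) (T T' : system) :
  system_eq Om T T' -> system_eq Om T' T.
Proof.
  intros [H1 H2]; split; intros p Hp;
    [destruct (H1 p Hp) as (? & ? & ? & ? & ? & ? & ?)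
    | destruct (H2 p Hp) as (? & ? & ? & ? & ? & ? & ?)]; repeat split; now symmetry.
Qed.

Lemma has_skeleton_ext (Om : plane -> Prop) (T T' : system) (K : skeleton) :
  system_eq Om T T' -> has_skeleton Om T K -> has_skeleton Om T' K.
Proof.
  intros [H1 H2] [HK (M & HM & [E1 E2])]. split; [exact HK |].
  exists M. split; [exact HM |].
  split; intros p Hp;
    destruct (H1 p Hp) as (e1 & e2 & e3 & e4 & e5 & e6 & e7);
    destruct (H2 p Hp) as (e1' & e2' & e3' & e4' & e5' & e6' & e7');
    [specialize (E1 p Hp) | specialize (E2 p Hp)]; cbn in *;
    rewrite <- e1, <- e2, <- e3, <- e4, <- e5, <- e6, <- e7,
      <- e1', <- e2', <- e3', <- e4', <- e5', <- e6', <- e7'; assumption.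
Qed.

(** The real-linear map [z |-> l2 z - l * l1 z] sends the real basis [a, l * a]
    to [1, l], so it is division by [a]. *)
Lemma rows_div (m11 m12 m21 m22 : R) (l a z : C) :
  m11 * Re a + m12 * Im a = 0 -> m21 * Re a + m22 * Im a = 1 ->
  m11 * Re (l * a)%C + m12 * Im (l * a)%C = -1 ->
  m21 * Re (l * a)%C + m22 * Im (l * a)%C = 0 ->
  (a * (RtoC (m21 * Re z + m22 * Im z) - l * RtoC (m11 * Re z + m12 * Im z)))%C = z.
Proof.
  destruct l as [s t], a as [p q], z as [x y]; simpl. intros h1 h2 h3 h4.
  (* Since $la=s\,a+t\,ia$, the known values on $a$ and $la$ give the value of each row on $ia$,
     which for the first row is [m12 * p - m11 * q]. *)
  assert (h3' : t * (m12 * p - m11 * q) = -1).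
  { rewrite <- h3. transitivity (t * (m12 * p - m11 * q) + s * 0); [ring |].
    rewrite <- h1. ring. }
  assert (h4' : t * (m22 * p - m21 * q) = - s).
  { transitivity (0 - s * 1); [| ring]. rewrite <- h2, <- h4. ring. }
  assert (Ht : t <> 0) by (intros ->; lra).
  assert (k1 : m12 * p - m11 * q = - / t).
  { apply Rmult_eq_reg_l with t; [| exact Ht]. rewrite h3'. now field. }
  assert (k2 : m22 * p - m21 * q = - s / t).
  { apply Rmult_eq_reg_l with t; [| exact Ht]. rewrite h4'. now field. }
  assert (Hn : p * p + q * q <> 0).
  { intros H. assert (p = 0) by nra. assert (q = 0) by nra. subst. lra. }
  (* Each row is now known on the orthogonal basis $a$, $ia$, both of squared length $p^2+q^2$, and
     its entries follow by projection. *)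
  assert (e11 : m11 = q / t / (p * p + q * q)).
  { apply Rmult_eq_reg_r with (p * p + q * q); [| exact Hn].
    transitivity (p * (m11 * p + m12 * q) - q * (m12 * p - m11 * q)); [ring |].
    rewrite h1, k1. now field. }
  assert (e12 : m12 = - p / t / (p * p + q * q)).
  { apply Rmult_eq_reg_r with (p * p + q * q); [| exact Hn].
    transitivity (q * (m11 * p + m12 * q) + p * (m12 * p - m11 * q)); [ring |].
    rewrite h1, k1. now field. }
  assert (e21 : m21 = (p + q * s / t) / (p * p + q * q)).
  { apply Rmult_eq_reg_r with (p * p + q * q); [| exact Hn].
    transitivity (p * (m21 * p + m22 * q) - q * (m22 * p - m21 * q)); [ring |].
    rewrite h2, k2. now field. }
  assert (e22 : m22 = (q - p * s / t) / (p * p + q * q)).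
  { apply Rmult_eq_reg_r with (p * p + q * q); [| exact Hn].
    transitivity (q * (m21 * p + m22 * q) + p * (m22 * p - m21 * q)); [ring |].
    rewrite h2, k2. now field. }
  apply injective_projections; simpl; rewrite e11, e12, e21, e22; field; auto.
Qed.

(** In complex form, row 2 minus [l] times row 1 of the skeleton is the complex
    equation divided by its coefficient of [v_x]. *)
Lemma skeleton_coefs (Om : plane -> Prop) (l cux cuy cvx cvy cu cv r : plane -> C)
    (K : skeleton) :
  (forall p, Om p -> cvy p = l p * cvx p)%C ->
  has_skeleton Om (real_system cux cuy cvx cvy cu cv r) K ->
  forall p, Om p ->
    (cvx p * (a21 K p - l p * a11 K p) = cux p)%C /\
    (cvx p * (a22 K p - l p * a12 K p) = cuy p)%C /\
    (cvx p * (a23 K p - l p * a13 K p) = cu p)%C /\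
    (cvx p * (a24 K p - l p * a14 K p) = cv p)%C /\
    (cvx p * (f2 K p - l p * f1 K p) = r p)%C.
Proof.
  intros Hl [_ (M & _ & [E1 E2])] p Hp.
  destruct (E1 p Hp) as (e1 & e2 & e3 & e4 & e5 & e6 & e7).
  destruct (E2 p Hp) as (e1' & e2' & e3' & e4' & e5' & e6' & e7').
  cbn in *. rewrite (Hl p Hp) in e4, e4'.
  rewrite <- e1, <- e2, <- e5, <- e6, <- e7, <- e1', <- e2', <- e5', <- e6', <- e7'.
  repeat split; now apply rows_div.
Qed.

(** Real solutions of [row2 - l * row1 = z]. *)
Definition row1 (l z : C) : R := - (Im z * / Im l).
Definition row2 (l z : C) : R := Re z + Re l * row1 l z.

(** The normalising matrix: its columns are the images of $1$ and $i$ under the real-linear map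
    [z |-> (row1 l (z / a), row2 l (z / a))]. Its determinant is $1/\operatorname{Im}l$ from the
    rows times $1/|a|^2$ from the division. *)
Lemma rows_div_exist (l a : C) : Im l <> 0 -> a <> 0 ->
  (forall z, row1 l (/ a) * Re z + row1 l (Ci / a) * Im z = row1 l (z / a)) /\
  (forall z, row2 l (/ a) * Re z + row2 l (Ci / a) * Im z = row2 l (z / a)) /\
  row1 l (/ a) * row2 l (Ci / a) - row1 l (Ci / a) * row2 l (/ a) <> 0.
Proof.
  intros Hl Ha. apply norm2_pos in Ha. destruct l as [s t], a as [p q].
  unfold row2, row1; simpl in *. repeat split.
  - intros [x y]; simpl. field; lra.
  - intros [x y]; simpl. field; lra.
  - match goal with |- ?e <> 0 => replace e with (/ (t * (p ^ 2 + q ^ 2))) end.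
    + apply Rinv_neq_0_compat, Rmult_integral_contrapositive; lra.
    + field; lra.
Qed.

Lemma C0_row (Om : plane -> Prop) (l f : plane -> C) :
  open Om -> CC0_on Om l -> (forall p, Om p -> Im (l p) <> 0) -> CC0_on Om f ->
  C0_on Om (fun p => row1 (l p) (f p)) /\ C0_on Om (fun p => row2 (l p) (f p)).
Proof.
  intros oOm [l1 l2] Hn [h1 h2].
  assert (H : C0_on Om (fun p => row1 (l p) (f p))).
  { apply C0_opp, C0_mult, C0_inv; assumption. }
  split; [exact H |]. apply C0_plus, C0_mult; assumption.
Qed.

Lemma C1_row (Om : plane -> Prop) (l f : plane -> C) :
  open Om -> CC1_on Om l -> (forall p, Om p -> Im (l p) <> 0) -> CC1_on Om f ->
  C1_on Om (fun p => row1 (l p) (f p)) /\ C1_on Om (fun p => row2 (l p) (f p)).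
Proof.
  intros oOm [l1 l2] Hn [h1 h2].
  assert (H : C1_on Om (fun p => row1 (l p) (f p))).
  { apply C1_opp, C1_mult, C1_inv; assumption. }
  split; [exact H |]. apply C1_plus, C1_mult; assumption.
Qed.

(** The coefficient of $v_y$ is understood to be [l * cvx]: after division by [cvx] the
    $v$-derivatives have coefficients $1$ and $l$, whose rows are exactly the normalised entries
    $(0,1)$ and $(-1,0)$. *)
Definition row_skeleton (l cux cuy cvx cu cv r : plane -> C) : skeleton :=
  let r1 f p := row1 (l p) (f p / cvx p)%C in
  let r2 f p := row2 (l p) (f p / cvx p)%C in
  Skeleton (r1 cux) (r1 cuy) (r1 cu) (r1 cv) (r2 cux) (r2 cuy) (r2 cu) (r2 cv)
    (r1 r) (r2 r).

(** The four principal coefficients depend only on [l] and the ratio [b / a], so the $C^1$ condition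
    is put on the ratio. Its negative imaginary part makes
    $a_{11}=-\operatorname{Im}(b/a)/\operatorname{Im}l$ positive. *)
Lemma has_skeleton_exists (Om : plane -> Prop) (l a b cu cv r : plane -> C) :
  open Om -> CC1_on Om l -> (forall p, Om p -> 0 < Im (l p)) ->
  CC1_on Om (fun p => b p / a p)%C -> CC0_on Om a -> (forall p, Om p -> a p <> 0) ->
  (forall p, Om p -> Im (b p / a p)%C < 0) ->
  CC0_on Om cu -> CC0_on Om cv -> CC0_on Om r ->
  let lb := fun p => (l p * b p)%C in
  let la := fun p => (l p * a p)%C in
  has_skeleton Om (real_system b lb a la cu cv r) (row_skeleton l b lb a cu cv r).
Proof.
  intros oOm Hl Hl0 Hba Ha Ha0 Hb Hu Hv Hr lb la.
  assert (Hln : forall p, Om p -> Im (l p) <> 0) by (intros p Hp; specialize (Hl0 p Hp); lra).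
  assert (Hlc : CC0_on Om l) by now apply CC1_CC0.
  assert (Hlba : CC1_on Om (fun p => lb p / a p)%C).
  { apply CC1_ext_on with (fun p => l p * (b p / a p))%C; trivial.
    - intros p Hp. unfold lb. field. now apply Ha0.
    - now apply CC1_mult. }
  split; [split; [| split] |].
  - destruct (C1_row Om l _ oOm Hl Hln Hba), (C1_row Om l _ oOm Hl Hln Hlba).
    refine (conj _ (conj _ (conj _ _))); assumption.
  - destruct (C0_row Om l _ oOm Hlc Hln (CC0_div Om _ _ Ha0 Hu Ha)),
      (C0_row Om l _ oOm Hlc Hln (CC0_div Om _ _ Ha0 Hv Ha)),
      (C0_row Om l _ oOm Hlc Hln (CC0_div Om _ _ Ha0 Hr Ha)).
    refine (conj _ (conj _ (conj _ (conj _ (conj _ _))))); assumption.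
  - intros p Hp. cbn. unfold lb.
    replace (l p * b p / a p)%C with (l p * (b p / a p))%C by (field; now apply Ha0).
    specialize (Hb p Hp). specialize (Hl0 p Hp).
    destruct (b p / a p)%C as [x y], (l p) as [s t]. unfold row2, row1; simpl in *.
    assert (0 < / t) by now apply Rinv_0_lt_compat.
    split; [nra |].
    (* The ellipticity discriminant is exactly $\operatorname{Im}(b/a)^2$. *)
    match goal with |- 0 < ?e => replace e with (y * y) by (field; lra) end. nra.
  - exists (MatrixField
      (fun p => row1 (l p) (/ a p)) (fun p => row1 (l p) (Ci / a p))
      (fun p => row2 (l p) (/ a p)) (fun p => row2 (l p) (Ci / a p)))%C.
    split.
    + destruct (C0_row Om l _ oOm Hlc Hln (CC0_inv Om _ Ha0 Ha)),
        (C0_row Om l _ oOm Hlc Hln (CC0_div Om _ _ Ha0 (CC0_const Om Ci) Ha)).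
      split; [| split; [| split; [| split]]]; try assumption.
      intros p Hp. now apply rows_div_exist; [apply Hln | apply Ha0].
    + split; intros p Hp; destruct (rows_div_exist (l p) (a p) (Hln p Hp) (Ha0 p Hp))
        as (R1 & R2 & _); specialize (Hln p Hp); specialize (Ha0 p Hp);
      assert (e1 : (a p / a p = 1)%C) by (now field);
      assert (e2 : (l p * a p / a p = l p)%C) by (now field);
      cbn -[Re Im row1 row2 Cdiv Cinv Cmult]; unfold la; rewrite ?R1, ?R2, ?e1, ?e2;
      repeat split; try reflexivity; unfold row2, row1; simpl; field; assumption.
Qed.

(** * The normal form of a substituted system *)

Lemma Cmod_lt_sqr (z w : C) :
  Cmod z < Cmod w -> Re z ^ 2 + Im z ^ 2 < Re w ^ 2 + Im w ^ 2.
Proof. exact (sqrt_lt_0_alt _ _). Qed.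

Lemma Cminus_eq_0 (z w : C) : (z - w = 0)%C -> z = w.
Proof. intros E. replace z with (z - w + w)%C by ring. rewrite E. ring. Qed.

Lemma Cmod_lt_minus_neq_0 (z w : C) : Cmod z < Cmod w -> (w - z)%C <> 0.
Proof. intros H E. apply Cminus_eq_0 in E. subst. lra. Qed.

(** This Cayley transform has imaginary part $(1-|m|^2)/|1-m|^2$. *)
Lemma Im_spectral_root_pos (m : C) :
  Cmod m < 1 -> 0 < Im (Ci * (1 + m) / (1 - m))%C.
Proof.
  intros H. assert (H1 : Cmod m < Cmod 1) by now rewrite Cmod_1.
  pose proof (norm2_pos _ (Cmod_lt_minus_neq_0 _ _ H1)) as Hn.
  apply Cmod_lt_sqr in H1. destruct m as [x y]; simpl in *.
  match goal with |- 0 < ?e =>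
    replace e with ((1 - x ^ 2 - y ^ 2) / ((1 - x) ^ 2 + y ^ 2)) end.
  - apply Rdiv_lt_0_compat; nra.
  - field. nra.
Qed.

(** The imaginary part is $-(|f|^2-|g|^2)/|f-g|^2$. Through it, $|\varphi|>|\psi|$ becomes
    ellipticity of the skeleton. *)
Lemma Im_ratio_neg (f g : C) :
  Cmod g < Cmod f -> Im ((f + g) / (Ci * (f - g)))%C < 0.
Proof.
  intros H. pose proof (norm2_pos _ (Cmod_lt_minus_neq_0 _ _ H)) as Hn.
  apply Cmod_lt_sqr in H. destruct f as [a b], g as [c d]; simpl in *.
  match goal with |- ?e < 0 =>
    replace e with (- ((a ^ 2 + b ^ 2 - c ^ 2 - d ^ 2) / ((a - c) ^ 2 + (b - d) ^ 2))) end.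
  - apply Ropp_lt_gt_0_contravar, Rdiv_lt_0_compat; nra.
  - field. nra.
Qed.

Lemma Ci_neq_0 : Ci <> 0.
Proof. intros E. apply (f_equal Im) in E. simpl in E. lra. Qed.

Lemma Cconj_neq_0 (z : C) : z <> 0 -> Cconj z <> 0.
Proof.
  intros H E. apply H. rewrite <- (Cconj_conj z), E. apply injective_projections; simpl; ring.
Qed.

Lemma neq_0_of_Im (z : C) : 0 < Im z -> z <> 0.
Proof. intros H ->. simpl in H. lra. Qed.

(** Test at $(1,0)$ and $(0,1)$: the second identity minus $\bar l$ times the first eliminates [b]
    and leaves $a\,(l-\bar l)$, with $l\ne\bar l$. *)
Lemma conj_pair_unique (l a b a' b' : C) :
  0 < Im l ->
  (forall U V : R, a * (U + l * V) + b * (U + Cconj l * V) =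
     a' * (U + l * V) + b' * (U + Cconj l * V))%C ->
  a = a' /\ b = b'.
Proof.
  intros Hl H. pose proof (H 1 0) as H1. pose proof (H 0 1) as H2.
  assert (Hd : (l - Cconj l)%C <> 0).
  { apply neq_0_of_Im. destruct l; simpl in *; lra. }
  assert (E : a = a').
  { apply Cminus_eq_0.
    replace (a - a')%C with
      (((a * (0 + l * 1) + b * (0 + Cconj l * 1) - Cconj l * (a * (1 + l * 0) + b * (1 + Cconj l * 0)))
        - (a' * (0 + l * 1) + b' * (0 + Cconj l * 1) - Cconj l * (a' * (1 + l * 0) + b' * (1 + Cconj l * 0))))
        / (l - Cconj l))%C by (field; exact Hd).
    rewrite H1, H2. field. exact Hd. }
  split; [exact E |]. subst a'. apply Cminus_eq_0.
  replace (b - b')%C with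
    ((a * (1 + l * 0) + b * (1 + Cconj l * 0)) - (a * (1 + l * 0) + b' * (1 + Cconj l * 0)))%C
    by ring.
  rewrite H1. ring.
Qed.

(** With real coefficients the other root is $\bar l$, so $\beta=-2\operatorname{Re}l$,
    $\alpha=|l|^2$ and the square root is that of $(2\operatorname{Im}l)^2$. *)
Lemma upper_root (l : C) (al be : R) :
  0 < Im l -> (l * l + be * l + al = 0)%C ->
  (/ 2 * (- be + Ci * sqrt (4 * al - be ^ 2)%R))%C = l.
Proof.
  destruct l as [s t]; intros Ht E; simpl in Ht.
  pose proof (f_equal Re E) as E1. pose proof (f_equal Im E) as E2. simpl in E1, E2.
  assert (be = -2 * s) by (apply Rmult_eq_reg_l with t; nra). subst be.
  assert (al = s * s + t * t) by nra. subst al.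
  replace (4 * (s * s + t * t) - (-2 * s) ^ 2)%R with ((2 * t) * (2 * t))%R by ring.
  rewrite sqrt_square by lra.
  apply injective_projections; simpl; field.
Qed.

(** * The substituted system and its gauge factor *)

Section Substitution.

Context (Om : plane -> Prop) (oOm : open Om) (D : bv_data) (hD : BV Om D)
  (phi psi : plane -> C) (hphi : CC1_on Om phi) (hpsi : CC1_on Om psi)
  (hS : forall p, Om p -> Cmod (psi p) < Cmod (phi p)).

Let mu := bv_mu D.
Let lam := spectral_root D.
Let k p := ((1 - mu p) / 2)%C.
Let P p := (phi p + psi p)%C.
Let Q p := (Ci * (phi p - psi p))%C.
Let gam p := (- Ci * lam p / (phi p - psi p))%C.

Lemma one_minus_mu_neq_0 p : Om p -> (1 - mu p)%C <> 0.
Proof.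
  intros Hp. apply Cmod_lt_minus_neq_0. rewrite Cmod_1. now apply hD.
Qed.

Lemma half_neq_0 p : Om p -> k p <> 0.
Proof.
  intros Hp E. apply (one_minus_mu_neq_0 p Hp).
  replace (1 - mu p)%C with (2 * k p)%C by (unfold k; field).
  rewrite E. ring.
Qed.


Lemma minus_neq_0 p : Om p -> (phi p - psi p)%C <> 0.
Proof. intros Hp. now apply Cmod_lt_minus_neq_0, hS. Qed.

Lemma Q_neq_0 p : Om p -> Q p <> 0.
Proof. intros Hp. apply Cmult_neq_0; [apply Ci_neq_0 | now apply minus_neq_0]. Qed.

Lemma Im_lam_pos p : Om p -> 0 < Im (lam p).
Proof. intros Hp. now apply Im_spectral_root_pos, hD. Qed.

Lemma lam_neq_0 p : Om p -> lam p <> 0.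
Proof. intros Hp. now apply neq_0_of_Im, Im_lam_pos. Qed.

Lemma gam_Q p : Om p -> (gam p * Q p)%C = lam p.
Proof.
  intros Hp. unfold gam, Q.
  (* [field] treats [Ci] as an atom; $i^2=-1$ is used only in the componentwise step. *)
  transitivity (- (Ci * Ci) * lam p)%C; [field; now apply minus_neq_0 |].
  apply injective_projections; simpl; ring.
Qed.

Lemma gam_neq_0 p : Om p -> gam p <> 0.
Proof.
  intros Hp E. apply (lam_neq_0 p Hp). rewrite <- (gam_Q p Hp), E. ring.
Qed.

Lemma CC1_lam : CC1_on Om lam.
Proof.
  destruct hD as [Hmu _].
  pose proof (CC1_const Om oOm 1) as H1. pose proof (CC1_const Om oOm Ci) as Hi.
  apply CC1_div; [exact oOm | exact one_minus_mu_neq_0 | |].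
  - apply CC1_mult, CC1_plus; assumption.
  - apply CC1_minus; assumption.
Qed.

Lemma CC1_P : CC1_on Om P.
Proof. now apply CC1_plus. Qed.

Lemma CC1_Q : CC1_on Om Q.
Proof. apply CC1_mult; trivial; [now apply CC1_const | now apply CC1_minus]. Qed.

Lemma CC1_gam : CC1_on Om gam.
Proof.
  apply CC1_div; trivial; [exact minus_neq_0 | | now apply CC1_minus].
  apply CC1_mult; trivial; [now apply CC1_const | exact CC1_lam].
Qed.

Lemma CC0_half : CC0_on Om k.
Proof.
  destruct hD as [Hmu _].
  apply CC0_mult; [apply CC0_minus; [apply CC0_const | now apply CC1_CC0] | apply CC0_const].
Qed.

Lemma dzbar_minus_mu_dz (f : plane -> C) p :
  Om p -> (dzbar f p - mu p * dz f p)%C = (k p * along lam f p)%C.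
Proof.
  intros Hp. pose proof (one_minus_mu_neq_0 p Hp).
  unfold dzbar, dz, along, k, lam, spectral_root, mu in *. field; trivial.
Qed.

(** Zero-order coefficients: derivatives falling on [P] and [Q] land here, and as $u,v$ are real,
    $\bar w$ contributes $\bar P$ and $\bar Q$. *)
Let zero_u p := (k p * along lam P p + bv_A D p * P p + bv_B D p * Cconj (P p))%C.
Let zero_v p := (k p * along lam Q p + bv_A D p * Q p + bv_B D p * Cconj (Q p))%C.

Definition substituted_system : system :=
  real_system (fun p => k p * P p)%C (fun p => lam p * (k p * P p))%C
    (fun p => k p * Q p)%C (fun p => lam p * (k p * Q p))%C zero_u zero_v (bv_F D).

Lemma substituted_system_correct : is_substituted Om D phi psi substituted_system.
Proof.
  intros u v Hu Hv v' w p Hp.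
  pose (w' := fun q => (P q * RtoC (u q) + Q q * RtoC (v q))%C).
  assert (Ew : forall q, w q = w' q).
  { intros q. apply injective_projections; simpl; ring. }
  assert (CCu : CC1_on Om (fun q => RtoC (u q))) by now apply CC1_RtoC.
  assert (CCv : CC1_on Om (fun q => RtoC (v q))) by now apply CC1_RtoC.
  assert (E : Res D w p =
    (k p * P p * dx u p + lam p * (k p * P p) * dy u p + k p * Q p * dx v p
     + lam p * (k p * Q p) * dy v p + zero_u p * u p + zero_v p * v p - bv_F D p)%C).
  { unfold Res. fold mu. rewrite (dzbar_minus_mu_dz w p Hp).
    rewrite (along_ext_on Om oOm lam lam w w' p (fun _ _ => eq_refl) (fun q _ => Ew q) Hp).
    rewrite (Ew p). unfold w'.
    rewrite (along_plus Om lam _ _ p (CC1_mult Om oOm _ _ CC1_P CCu)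
      (CC1_mult Om oOm _ _ CC1_Q CCv) Hp), (along_mult Om oOm lam _ _ p CC1_P CCu Hp),
      (along_mult Om oOm lam _ _ p CC1_Q CCv Hp), !along_RtoC.
    rewrite Cplus_conj, !Cmult_conj.
    replace (Cconj (RtoC (u p))) with (RtoC (u p))
      by (apply injective_projections; simpl; ring).
    replace (Cconj (RtoC (v p))) with (RtoC (v p))
      by (apply injective_projections; simpl; ring).
    unfold zero_u, zero_v. ring. }
  rewrite E. exact (residual_real_system _ _ _ _ _ _ _ u v p).
Qed.

Lemma substituted_system_skeleton :
  exists K, has_skeleton Om substituted_system K.
Proof.
  eexists. apply has_skeleton_exists; trivial.
  - exact CC1_lam.
  - exact Im_lam_pos.
  - apply CC1_ext_on with (fun p => P p / Q p)%C; trivial.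
    + intros p Hp. field. split; [now apply Q_neq_0 | now apply half_neq_0].
    + apply CC1_div; trivial; [exact Q_neq_0 | exact CC1_P | exact CC1_Q].
  - apply CC0_mult; [exact CC0_half | apply CC1_CC0, CC1_Q].
  - intros p Hp. apply Cmult_neq_0; [now apply half_neq_0 | now apply Q_neq_0].
  - intros p Hp. replace (k p * P p / (k p * Q p))%C with (P p / Q p)%C.
    + now apply Im_ratio_neg, hS.
    + field. split; [now apply Q_neq_0 | now apply half_neq_0].
  - destruct hD as (_ & _ & HA & HB & _).
    apply CC0_plus; [apply CC0_plus |]; apply CC0_mult; trivial; try apply CC0_conj.
    + exact CC0_half.
    + apply CC0_along; [apply CC1_CC0, CC1_lam | exact CC1_P].
    + apply CC1_CC0, CC1_P.
    + apply CC1_CC0, CC1_P.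
  - destruct hD as (_ & _ & HA & HB & _).
    apply CC0_plus; [apply CC0_plus |]; apply CC0_mult; trivial; try apply CC0_conj.
    + exact CC0_half.
    + apply CC0_along; [apply CC1_CC0, CC1_lam | exact CC1_Q].
    + apply CC1_CC0, CC1_Q.
    + apply CC1_CC0, CC1_Q.
  - now destruct hD as (_ & _ & _ & _ & HF).
Qed.

Lemma gauge_BV : BV Om (gauge gam D).
Proof.
  destruct hD as (Hmu & Hmu1 & HA & HB & HF).
  pose proof CC1_gam as Hg. pose proof (CC1_CC0 Om _ Hg) as Hg0.
  split; [exact Hmu | split; [exact Hmu1 | split; [| split]]].
  (* The two logarithmic-derivative terms of the gauge action combine into one application of
     $\partial_x+\lambda\partial_y$. *)
  - apply CC0_ext_on with (fun p => bv_A D p - k p * along lam gam p / gam p)%C; trivial.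
    + intros p Hp. rewrite <- (dzbar_minus_mu_dz gam p Hp). cbn. fold mu.
      field. now apply gam_neq_0.
    + apply CC0_minus; trivial. apply CC0_div; [exact gam_neq_0 | | trivial].
      apply CC0_mult; [exact CC0_half | apply CC0_along; [apply CC1_CC0, CC1_lam | trivial]].
  - apply CC0_mult; trivial. apply CC0_div; trivial; [| now apply CC0_conj].
    intros p Hp. now apply Cconj_neq_0, gam_neq_0.
  - now apply CC0_mult.
Qed.

(** * Normal forms computed from an arbitrary skeleton of the substituted system *)

Section Skeleton.

Context (K : skeleton) (hK : has_skeleton Om substituted_system K).

(** The relations of [skeleton_coefs] with [cvx] equal to [k * Q], rewritten by [gam * Q = lam] to
    remove [Q]. *)
Lemma skeleton_gam p : Om p ->
  (a22 K p - lam p * a12 K p)%C = (gam p * P p)%C /\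
  (lam p * (a21 K p - lam p * a11 K p))%C = (gam p * P p)%C /\
  (k p * lam p * (a23 K p - lam p * a13 K p))%C = (gam p * zero_u p)%C /\
  (k p * lam p * (a24 K p - lam p * a14 K p))%C = (gam p * zero_v p)%C /\
  (k p * lam p * (f2 K p - lam p * f1 K p))%C = (gam p * bv_F D p)%C.
Proof.
  intros Hp.
  destruct (skeleton_coefs Om lam _ _ _ _ _ _ _ K (fun q _ => eq_refl) hK p Hp)
    as (e1 & e2 & e3 & e4 & e5).
  pose proof (half_neq_0 p Hp) as Hk. pose proof (Q_neq_0 p Hp) as HQ.
  pose proof (gam_Q p Hp) as Hg.
  repeat split.
  - transitivity (k p * Q p * (a22 K p - lam p * a12 K p) / (k p * Q p))%C; [now field |].
    rewrite e2, <- Hg. now field.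
  - transitivity (gam p * (k p * Q p * (a21 K p - lam p * a11 K p)) / k p)%C;
      [rewrite <- Hg at 1; now field |].
    rewrite e1. now field.
  - rewrite <- e3, <- Hg at 1. ring.
  - rewrite <- e4, <- Hg at 1. ring.
  - rewrite <- e5, <- Hg at 1. ring.
Qed.

Lemma a11_pos p : Om p -> 0 < a11 K p.
Proof. intros Hp. now apply hK. Qed.

Lemma a22_pos p : Om p -> 0 < a22 K p.
Proof.
  intros Hp. destruct hK as [(_ & _ & H) _]. destruct (H p Hp) as [H1 H2].
  pose proof (pow2_ge_0 (a12 K p + a21 K p)). apply Rmult_lt_reg_l with (1 := H1). lra.
Qed.

(** Two expressions in [skeleton_gam] equal [gam * P]; equating them gives
    $a_{11}\lambda^2-(a_{12}+a_{21})\lambda+a_{22}=0$, which is divided by $a_{11}$. *)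
Lemma lam_root p : Om p ->
  (lam p * lam p + k_beta K p * lam p + k_alpha K p = 0)%C.
Proof.
  intros Hp. destruct (skeleton_gam p Hp) as (e1 & e2 & _). rewrite <- e1 in e2.
  pose proof (a11_pos p Hp) as H11.
  assert (H : RtoC (a11 K p) <> 0) by (intros E; apply RtoC_inj in E; lra).
  unfold k_alpha, k_beta.
  rewrite !RtoC_div, RtoC_opp, RtoC_plus by lra.
  transitivity ((a22 K p - lam p * a12 K p - lam p * (a21 K p - lam p * a11 K p)) / a11 K p)%C;
    [now field |].
  rewrite e2. now field.
Qed.

Lemma k_lambda_eq p : Om p -> k_lambda K p = lam p.
Proof. intros Hp. apply upper_root; [now apply Im_lam_pos | now apply lam_root]. Qed.

Lemma k_mu_eq p : Om p -> k_mu K p = mu p.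
Proof.
  intros Hp. pose proof (one_minus_mu_neq_0 p Hp) as Hm.
  unfold k_mu. rewrite (k_lambda_eq p Hp). unfold lam, spectral_root. fold mu.
  field. split; [exact Hm |].
  (* The denominator $\lambda+i$ is $2i/(1-\mu)$. *)
  replace (Ci * (1 + mu p) + Ci * (1 - mu p))%C with (2 * Ci)%C by ring.
  apply Cmult_neq_0; [| exact Ci_neq_0]. intros E. apply RtoC_inj in E. lra.
Qed.

(** [W = U + lam V] is [gam w] with [w = P u + Q v], and [gam Q = lam],
    [gam P = a22 - lam a12]; so the derivatives of the coefficients recombine into
    [- w (d_x + lam d_y) gam] by the product rule. *)
Lemma canonical_zero_order p (G1 G2 : R) : Om p ->
  along lam lam p = (G1 + G2 * lam p)%C ->
  forall U V : R,
  (bv_A (gauge gam D) p * (U + lam p * V) + bv_B (gauge gam D) p * (U + Cconj (lam p) * V)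
   = (1 - mu p) * (/ 2 * ((k_a K p * U + (k_b K p - G1) * V)
                 + lam p * (k_c K p * U + (k_d K p - G2) * V))))%C.
Proof.
  intros Hp HG U V.
  destruct (skeleton_gam p Hp) as (e1 & _ & e3 & e4 & _).
  pose proof (a22_pos p Hp) as H22.
  (* Return to the skeleton unknowns; the denominators [a22] of [k_a] and [k_c] cancel against
     $U=a_{22}u$. *)
  pose (u := U / a22 K p). pose (v := V + a12 K p * u).
  assert (EU : U = a22 K p * u) by (unfold u; field; lra).
  assert (EV : V = v - a12 K p * u) by (unfold v; ring).
  assert (Ea : k_a K p * U = (- dx (a22 K) p - k_alpha K p * dy (a12 K) p
    + k_alpha K p * a13 K p + k_alpha K p * a14 K p * a12 K p) * u)
    by (unfold k_a, u; field; lra).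
  assert (Ec : k_c K p * U = (dx (a12 K) p - dy (a22 K) p - k_beta K p * dy (a12 K) p
    + a23 K p + k_beta K p * a13 K p + a12 K p * (a24 K p + k_beta K p * a14 K p)) * u)
    by (unfold k_c, u; field; lra).
  clearbody u v.
  assert (EW : (U + lam p * V = gam p * (P p * u + Q p * v))%C).
  { rewrite EU, EV, RtoC_minus, !RtoC_mult.
    transitivity ((a22 K p - lam p * a12 K p) * u + lam p * v)%C; [ring |].
    rewrite e1, <- (gam_Q p Hp). ring. }
  assert (EWc : (U + Cconj (lam p) * V
    = Cconj (gam p) * (Cconj (P p) * u + Cconj (Q p) * v))%C).
  { transitivity (Cconj (U + lam p * V)); [apply injective_projections; simpl; ring |].
    rewrite EW. apply injective_projections; simpl; ring. }
  (* Differentiate $a_{22}=\gamma P+\lambda a_{12}$, valid on all of [Om], along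
     $\partial_x+\lambda\partial_y$. *)
  assert (DP : (dx (a22 K) p + lam p * dy (a22 K) p - lam p * (dx (a12 K) p + lam p * dy (a12 K) p)
     - along lam lam p * a12 K p = along lam gam p * P p + gam p * along lam P p)%C).
  { destruct hK as [((_ & c12 & _ & c22) & _) _].
    pose proof (CC1_RtoC Om oOm _ c12) as C12. pose proof (CC1_RtoC Om oOm _ c22) as C22.
    pose proof CC1_P as CP.
    rewrite <- (along_mult Om oOm lam _ _ p CC1_gam CP Hp).
    rewrite <- !along_RtoC.
    rewrite (along_ext_on Om oOm lam lam (fun q => RtoC (a22 K q))
      (fun q => gam q * P q + lam q * RtoC (a12 K q))%C p (fun _ _ => eq_refl)).
    - rewrite (along_plus Om lam _ _ p (CC1_mult Om oOm _ _ CC1_gam CP)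
        (CC1_mult Om oOm _ _ CC1_lam C12) Hp).
      rewrite (along_mult Om oOm lam _ _ p CC1_lam C12 Hp). ring.
    - intros q Hq. rewrite <- (proj1 (skeleton_gam q Hq)). ring.
    - exact Hp. }
  assert (DQ : along lam lam p = (along lam gam p * Q p + gam p * along lam Q p)%C).
  { rewrite <- (along_mult Om oOm lam _ _ p CC1_gam CC1_Q Hp).
    apply (along_ext_on Om oOm); trivial. intros q Hq. symmetry. now apply gam_Q. }
  assert (Eal : RtoC (k_alpha K p) = (- (lam p * lam p + k_beta K p * lam p))%C).
  { rewrite <- (Cplus_0_r (Copp _)), <- (lam_root p Hp). ring. }
  (* By [DQ] this middle term is $\gamma(\mathcal Aw+\mathcal B\bar
     w)-k\,w\,(\partial_x+\lambda\partial_y)\gamma$, the gauged side. *)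
  transitivity (k p * (- u * (along lam gam p * P p + gam p * along lam P p)
    - v * along lam lam p) + u * (gam p * zero_u p) + v * (gam p * zero_v p))%C.
  - rewrite EW, EWc, DQ. unfold zero_u, zero_v. cbn -[Cmult Cplus Cminus Cdiv Copp]. fold mu.
    pose proof (gam_neq_0 p Hp) as Hg. pose proof (Cconj_neq_0 _ Hg) as Hgc.
    replace (bv_A D p - dzbar gam p / gam p + mu p * (dz gam p / gam p))%C
      with (bv_A D p - k p * along lam gam p / gam p)%C
      by (rewrite <- (dzbar_minus_mu_dz gam p Hp); field; exact Hg).
    field. now split.
  (* On the canonical side the derivatives of $\lambda$ collect into $-(G_1+G_2\lambda)V$, since
     $V=v-a_{12}u$. *)
  - rewrite <- DP, <- e3, <- e4, HG.
    apply (f_equal RtoC) in Ea, Ec.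
    repeat rewrite ?RtoC_mult, ?RtoC_plus, ?RtoC_minus, ?RtoC_opp in Ea.
    repeat rewrite ?RtoC_mult, ?RtoC_plus, ?RtoC_minus, ?RtoC_opp in Ec.
    rewrite Ea, Ec, EV. unfold k_b, k_d.
    rewrite ?RtoC_minus, ?RtoC_plus, ?RtoC_mult, Eal. unfold k. field.
Qed.

(** By the quadratic equation $\alpha+\beta\lambda=-\lambda^2$, so $f+\lambda g=\lambda(f_2-\lambda
    f_1)$, and the last relation of [skeleton_gam] applies. *)
Lemma canonical_rhs p : Om p ->
  ((1 - mu p) * (/ 2 * (k_f K p + lam p * k_g K p)))%C = bv_F (gauge gam D) p.
Proof.
  intros Hp. destruct (skeleton_gam p Hp) as (_ & _ & _ & _ & e5).
  assert (Eal : RtoC (k_alpha K p) = (- (lam p * lam p + k_beta K p * lam p))%C).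
  { rewrite <- (Cplus_0_r (Copp _)), <- (lam_root p Hp). ring. }
  cbn. rewrite <- e5. unfold k_f, k_g. rewrite RtoC_plus, !RtoC_mult, Eal.
  unfold k. field.
Qed.

Lemma along_k_lambda p : Om p ->
  along (k_lambda K) (k_lambda K) p = along lam lam p.
Proof. apply (along_ext_on Om oOm); exact k_lambda_eq. Qed.

(** For whatever [G1], [G2], [Al], [Bl] witness the normal form, [canonical_zero_order] gives the
    gauged pair the same identity in $U,V$, and [conj_pair_unique] concludes. *)
Lemma normal_form_unique DS :
  skeleton_normal_form Om K DS -> bv_eq Om DS (gauge gam D).
Proof.
  intros (G1 & G2 & Al & Bl & HG & HAB & Heq) p Hp.
  destruct (Heq p Hp) as (E1 & E2 & E3 & E4). cbn [bv_mu bv_A bv_B bv_F] in *.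
  specialize (HG p Hp). specialize (HAB p Hp).
  fold (along (k_lambda K) (k_lambda K) p) in HG.
  rewrite (along_k_lambda p Hp) in HG.
  rewrite (k_lambda_eq p Hp) in *. rewrite (k_mu_eq p Hp) in *.
  destruct (conj_pair_unique (lam p) (bv_A DS p) (bv_B DS p)
    (bv_A (gauge gam D) p) (bv_B (gauge gam D) p)) as [EA EB].
  - now apply Im_lam_pos.
  - intros U V. rewrite (canonical_zero_order p _ _ Hp HG), <- HAB, E2, E3. ring.
  - repeat split; trivial. rewrite E4. now apply canonical_rhs.
Qed.

Lemma normal_form_gauge : skeleton_normal_form Om K (gauge gam D).
Proof.
  (* Coordinates of $\lambda_x+\lambda\lambda_y$ in the real basis $1,\lambda$ of $\mathbb C$. *)
  pose (G2 := fun p => Im (along lam lam p) / Im (lam p)).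
  pose (G1 := fun p => Re (along lam lam p) - G2 p * Re (lam p)).
  assert (HG : forall p, Om p -> along lam lam p = (G1 p + G2 p * lam p)%C).
  { intros p Hp. pose proof (Im_lam_pos p Hp) as Hl. unfold G1, G2.
    destruct (lam p) as [s t], (along lam lam p) as [x y]. simpl in *.
    apply injective_projections; simpl; field; lra. }
  exists G1, G2, (fun p => bv_A (gauge gam D) p / (1 - mu p))%C,
    (fun p => bv_B (gauge gam D) p / (1 - mu p))%C.
  repeat split; cbn [bv_mu bv_A bv_B bv_F].
  - intros p Hp. fold (along (k_lambda K) (k_lambda K) p).
    rewrite (along_k_lambda p Hp), (k_lambda_eq p Hp). now apply HG.
  - intros p Hp U V. rewrite (k_lambda_eq p Hp).
    pose proof (one_minus_mu_neq_0 p Hp) as Hm.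
    transitivity ((bv_A (gauge gam D) p * (U + lam p * V)
      + bv_B (gauge gam D) p * (U + Cconj (lam p) * V)) / (1 - mu p))%C; [now field |].
    rewrite (canonical_zero_order p _ _ Hp (HG p Hp)). field. exact Hm.
  - symmetry. now apply k_mu_eq.
  - rewrite (k_mu_eq p H). pose proof (one_minus_mu_neq_0 p H). now field.
  - rewrite (k_mu_eq p H). pose proof (one_minus_mu_neq_0 p H). now field.
  - rewrite (k_mu_eq p H), (k_lambda_eq p H). symmetry. now apply canonical_rhs.
Qed.

End Skeleton.

End Substitution.

(** * Invariance of the density and proof of the theorem *)

Lemma Cmod_gauge_B (g : plane -> C) (D : bv_data) (p : plane) :
  g p <> 0 -> Cmod (bv_B (gauge g D) p) = Cmod (bv_B D p).
Proof.
  intros Hg. simpl. rewrite Cmod_mult, Cmod_div, Cmod_conj by now apply Cconj_neq_0.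
  field. now apply Rgt_not_eq, Cmod_gt_0.
Qed.

Lemma BV_ext_on (Om : plane -> Prop) (D E : bv_data) :
  open Om -> bv_eq Om D E -> BV Om E -> BV Om D.
Proof.
  intros oOm H (Hmu & Hmu1 & HA & HB & HF).
  split; [| split; [| split; [| split]]].
  - apply CC1_ext_on with (bv_mu E); trivial. intros q Hq. symmetry. now apply H.
  - intros p Hp. destruct (H p Hp) as [-> _]. now apply Hmu1.
  - apply CC0_ext_on with (bv_A E); trivial. intros q Hq. symmetry. now apply H.
  - apply CC0_ext_on with (bv_B E); trivial. intros q Hq. symmetry. now apply H.
  - apply CC0_ext_on with (bv_F E); trivial. intros q Hq. symmetry. now apply H.
Qed.

Theorem theorem1p1 (Om : plane -> Prop) (hOm : is_domain Om)
    (D : bv_data) (hD : BV Om D)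
    (phi psi : plane -> C) (hphi : CC1_on Om phi) (hpsi : CC1_on Om psi)
    (hS : forall p, Om p -> Cmod (psi p) < Cmod (phi p)) :
  let lam := spectral_root D in
  let phit := fun p => (- Ci * lam p / (phi p - psi p))%C in
  (forall p, Om p -> 0 < Im (lam p)) /\
  CC1_on Om phit /\ (forall p, Om p -> phit p <> RtoC 0) /\
  (exists T : system, is_substituted Om D phi psi T) /\
  (forall T : system, is_substituted Om D phi psi T ->
     admissible Om T /\
     (exists DS : bv_data, pipeline Om T DS) /\
     (forall DS : bv_data, pipeline Om T DS ->
        BV Om DS /\
        bv_eq Om DS (gauge phit D) /\
        (forall p, Om p ->
           bv_mu DS p = bv_mu D p /\
           Cmod (bv_B DS p) = Cmod (bv_B D p) /\
           density DS p = density D p))).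
Proof.
  intros lam phit. destruct hOm as [oOm _].
  assert (Hphit : forall p, Om p -> phit p <> RtoC 0)
    by (intros p Hp; now apply (gam_neq_0 Om D hD phi psi hS)).
  assert (HS := substituted_system_correct Om oOm D hD phi psi hphi hpsi).
  set (T0 := substituted_system D phi psi) in HS.
  split; [exact (Im_lam_pos Om D hD) |].
  split; [exact (CC1_gam Om oOm D hD phi psi hphi hpsi hS) |].
  split; [exact Hphit |].
  split; [exists T0; exact HS |].
  intros T HT.
  (* Any substituted system agrees on [Om] with the explicit [T0], so skeletons pass both ways: from
     [T0] to [T] for existence, from [T] to [T0] for uniqueness. *)
  pose proof (is_substituted_unique Om D phi psi T T0 oOm HT HS) as ET.
  destruct (substituted_system_skeleton Om oOm D hD phi psi hphi hpsi hS) as [K HK].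
  pose proof (has_skeleton_ext Om T0 T K (system_eq_sym Om T T0 ET) HK) as HKT.
  split; [now exists K |]. split.
  - exists (gauge phit D), K. split; [exact HKT |].
    exact (normal_form_gauge Om oOm D hD phi psi hphi hpsi hS K HK).
  - intros DS (K' & HK' & HDS).
    pose proof (has_skeleton_ext Om T T0 K' ET HK') as HK0.
    assert (E : bv_eq Om DS (gauge phit D))
      by exact (normal_form_unique Om oOm D hD phi psi hphi hpsi hS K' HK0 DS HDS).
    split; [| split; [exact E |]].
    + apply BV_ext_on with (gauge phit D); trivial.
      exact (gauge_BV Om oOm D hD phi psi hphi hpsi hS).
    + intros p Hp. destruct (E p Hp) as (E1 & _ & E3 & _).
      assert (EB : Cmod (bv_B DS p) = Cmod (bv_B D p))
        by (rewrite E3; apply Cmod_gauge_B; now apply Hphit).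
      split; [exact E1 | split; [exact EB |]].
      unfold density. rewrite EB, E1. reflexivity.
Qed.
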